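(* Let $\bar d=(d_j)_{j\ge 0}$ be integers with $d_0=1$ and $d_j\ge 2$ for $j\ge 1$, and let $\bar p=(p_j)_{j\ge 1}$ with $p_j\in(0,1]$. For every $\Omega\in\{c_0,\ l^\alpha,\ \alpha\ge1\}$ (with $\alpha$ real), if $\bar p$ does not converge to $1$, then the point spectrum $\sigma_p(\Omega,\bar d,\bar p)$ is empty.
   Context: $\mathbb{Z}_+=\{0,1,2,\dots\}$. Put $q_j=d_0d_1\cdots d_j$ for $j\ge 0$. Every $n\in\mathbb{Z}_+$ has a unique expansion $n=\sum_{j\ge1}a_j(n)q_{j-1}$ with digits $a_j(n)\in\{0,\dots,d_j-1\}$, only finitely many nonzero. Put $\zeta_n=\min\{j\ge1: a_j(n)\ne d_j-1\}$. Let $S=[s(n,m)]_{n,m\ge0}$ be the stochastic matrix with entries: $s(n,n+1)=\prod_{j=1}^{\zeta_n}p_j$; $s(n,n)=1-p_1$; if $\zeta_n\ge2$, for $1\le r\le\zeta_n-1$, $s\big(n,\,n-\sum_{j=1}^r(d_j-1)q_{j-1}\big)=(1-p_{r+1})\prod_{j=1}^rp_j$; and $s(n,m)=0$ otherwise. Column sums of $S$ are at most $1$, and $(Sw)(n)=\sum_m s(n,m)w(m)$ defines a bounded linear operator on each of the complex sequence spaces (indexed by $\mathbb{Z}_+$) $l^\alpha$ and $c_0$ (sequences tending to $0$, sup norm). $\sigma_p(\Omega,\bar d,\bar p)$ denotes the point spectrum (set of eigenvalues) of $S$ acting on $\Omega$. *)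

(* Defs.v *)
From HB Require Import structures.
From mathcomp Require Import all_boot all_order all_algebra.
From mathcomp Require Import complex.
From mathcomp Require Import all_classical all_reals all_analysis.

Set Implicit Arguments.
Unset Strict Implicit.
Unset Printing Implicit Defensive.

Import Order.TTheory GRing.Theory Num.Theory.
Import numFieldNormedType.Exports.

Local Open Scope classical_set_scope.
Local Open Scope ring_scope.
Local Open Scope complex_scope.

Definition cantor_base (d : nat -> nat) : Prop :=
  d 0%N = 1%N /\ forall j, (1 <= j)%N -> (2 <= d j)%N.

Section Digits.
Variable d : nat -> nat.

Definition cantor_q (j : nat) : nat := (\prod_(0 <= i < j.+1) d i)%N.

(* The digit a_j(n), meaningful for j >= 1; [digit_expansion] and
   [digit_unique] show that it is the one given by the expansion
   n = \sum_(j >= 1) a_j(n) q_(j-1). *)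
Definition digit (n j : nat) : nat := (n %/ cantor_q j.-1 %% d j)%N.

Lemma cantor_qS j : cantor_q j.+1 = (cantor_q j * d j.+1)%N.
Proof. by rewrite /cantor_q big_nat_recr. Qed.

Hypothesis hd : cantor_base d.

Lemma cantor_q0 : cantor_q 0 = 1%N.
Proof. by rewrite /cantor_q big_nat1; case: hd. Qed.

Lemma cantor_q_gt n : (n < cantor_q n)%N.
Proof.
elim: n => [|n IH]; first by rewrite cantor_q0.
rewrite cantor_qS (@leq_trans (cantor_q n * 2)%N)//; last first.
  by rewrite leq_mul2l (hd.2 n.+1 isT) orbT.
by rewrite muln2 -addnn (leq_ltn_trans IH)// -[ltnLHS]addn0 ltn_add2l
  (leq_ltn_trans _ IH).
Qed.

Lemma cantor_q_gt0 n : (0 < cantor_q n)%N.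
Proof. exact: leq_ltn_trans (cantor_q_gt n). Qed.

Lemma cantor_q_dvd j k : (j <= k)%N -> (cantor_q j %| cantor_q k)%N.
Proof.
move=> /subnK <-; elim: (k - j)%N => [|m IH]; first by rewrite add0n.
by rewrite addSn cantor_qS dvdn_mulr.
Qed.

Lemma digit_lt n j : (1 <= j)%N -> (digit n j < d j)%N.
Proof. by move=> /(hd.2) dj; rewrite ltn_pmod// (leq_trans _ dj). Qed.

Lemma digit_expansion n k :
  n = (\sum_(1 <= j < k.+1) digit n j * cantor_q j.-1 +
       n %/ cantor_q k * cantor_q k)%N.
Proof.
elim: k => [|k IH]; first by rewrite big_geq// cantor_q0 divn1 muln1.
rewrite big_nat_recr//= -addnA {1}IH; congr (_ + _)%N.
rewrite /digit /= {1}(divn_eq (n %/ cantor_q k) (d k.+1)) cantor_qS divnMA.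
by rewrite mulnDl addnC -!mulnA [(d k.+1 * _)%N]mulnC.
Qed.

Lemma digit_unique n k (a : nat -> nat) :
  (forall j, (1 <= j)%N -> (a j < d j)%N) ->
  n = (\sum_(1 <= j < k.+1) a j * cantor_q j.-1)%N ->
  forall j, (1 <= j <= k)%N -> a j = digit n j.
Proof.
move=> ad.
have small m : (\sum_(1 <= j < m.+1) a j * cantor_q j.-1 < cantor_q m)%N.
  elim: m => [|m IH]; first by rewrite big_geq// cantor_q0.
  rewrite big_nat_recr//= cantor_qS.
  apply: (@leq_trans (cantor_q m * (a m.+1).+1)%N).
    by rewrite mulnS mulnC ltn_add2r.
  by rewrite leq_mul2l ad ?orbT.
elim: k n => [|k IH] n ->; first by move=> [|j].
move=> j /andP[j1]; rewrite leq_eqVlt big_nat_recr//= addnC.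
set t := (\sum_(_ <= _ < _) _)%N => /orP[/eqP ->|].
  rewrite /digit /= divnMDl ?cantor_q_gt0// divn_small ?small// addn0.
  by rewrite modn_small ?ad.
rewrite ltnS => jk; rewrite (IH t erefl) ?j1// /digit.
have /dvdnP[m ->] := cantor_q_dvd jk.
rewrite -{3}(prednK j1) cantor_qS (prednK j1) [(cantor_q _ * d j)%N]mulnC.
by rewrite !mulnA divnMDl ?cantor_q_gt0// modnMDl.
Qed.

Lemma zeta_ex (n : nat) :
  exists j, (1 <= j)%N && (digit n j != (d j).-1).
Proof.
exists n.+1; rewrite /digit /= divn_small ?cantor_q_gt// mod0n.
by have := hd.2 n.+1 isT; case: (d n.+1) => [|[]].
Qed.

Definition zeta (n : nat) : nat := ex_minn (zeta_ex n).

End Digits.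

Section Operator.
Variables (R : realType) (d : nat -> nat) (hd : cantor_base d) (p : nat -> R).

(* For m < n the entry is written as a sum over 1 <= r <= zeta n - 1 in which
   at most one term satisfies the condition, as the sums
   \sum_(1 <= j <= r) (d_j - 1) q_(j-1) strictly increase with r; the
   condition is written additively to avoid truncated subtraction. *)
Definition stoch (n m : nat) : R :=
  if m == n.+1 then \prod_(1 <= j < (zeta hd n).+1) p j
  else if m == n then 1 - p 1%N
  else \sum_(1 <= r < zeta hd n |
             (m + \sum_(1 <= j < r.+1) (d j).-1 * cantor_q d j.-1 == n)%N)
         ((1 - p r.+1) * \prod_(1 <= j < r.+1) p j).

Lemma stoch_gt n m : (n.+1 < m)%N -> stoch n m = 0.
Proof.
move=> nm; rewrite /stoch gtn_eqF// gtn_eqF ?(ltnW nm)//.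
rewrite big1// => r /eqP E; move: nm; rewrite -E ltnNge.
by rewrite leqW// leq_addr.
Qed.

(* A finitely supported sum over all m, by [stoch_gt]. *)
Definition stoch_op (w : nat -> R[i]) : nat -> R[i] :=
  fun n => \sum_(m \in [set: nat]) (stoch n m)%:C * w m.

Lemma stoch_opE w n :
  stoch_op w n = \sum_(m < n.+2) (stoch n m)%:C * w m.
Proof.
rewrite -(big_mkord xpredT (fun m => (stoch n m)%:C * w m)) /stoch_op.
rewrite (@fsbigE _ _ _ _ _ (index_iota 0 n.+2)) ?iota_uniq//.
  by apply: eq_bigl => m; rewrite in_setT.
move=> m _; rewrite mem_index_iota /= -leqNgt => nm.
by rewrite stoch_gt// mul0r.
Qed.

End Operator.

Section Spaces.
Variable R : realType.

Definition c0_space : set (nat -> R[i]) :=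
  [set w | Normc.normc (w n) @[n --> \oo] --> (0 : R)].

Definition l_space (alpha : R) : set (nat -> R[i]) :=
  [set w | cvgn (series (fun n => Normc.normc (w n) `^ alpha))].

Definition point_spectrum (Omega : set (nat -> R[i]))
    (T : (nat -> R[i]) -> (nat -> R[i])) : set R[i] :=
  [set lambda | exists w, [/\ Omega w, w != 0 & forall n, T w n = lambda * w n]].

End Spaces.

Arguments c0_space R : clear implicits.

(* Main.v *)
(** An eigenvector [w] satisfies [w (q_k (t + 1)) = rho_k * w (q_k t)] as soon
    as [t] is not congruent to [-1] modulo [d_(k+1)], where
    [p_1 rho_0 = lambda - (1 - p_1)] and
    [p_(k+2) rho_(k+1) = rho_k ^ d_(k+1) - (1 - p_(k+2))].  In particular
    [w (q_k) = rho_k * w 0] with [w 0 <> 0].  If [w] tends to [0], as it does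
    in each of the spaces considered, then so does [rho], and the recurrence
    forces [p] to tend to [1]. *)
Require Import Defs.
From mathcomp Require Import all_boot all_order all_algebra.
From mathcomp Require Import complex.
From mathcomp Require Import all_classical all_reals all_analysis.
From mathcomp Require Import ring zify.
Import Order.TTheory GRing.Theory Num.Theory.
Import numFieldNormedType.Exports.
Local Open Scope classical_set_scope.
Local Open Scope ring_scope.

Lemma normc_ge0 (R : rcfType) (x : R[i]) : 0 <= Normc.normc x.
Proof. by case: x => ? ?; exact: sqrtr_ge0. Qed.

(** The terms of a convergent series tend to 0, and a power with positive exponent is small only if
    its base is. *)
Lemma c0_space_l_space (R : realType) (alpha : R) :
  1 <= alpha -> l_space alpha `<=` c0_space R.
Proof.
move=> a1 w /cvg_series_cvg_0 /cvgrPdist_lt w0.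
have a0 : 0 < alpha by rewrite (lt_le_trans _ a1).
apply/cvgrPdist_lt => e e0; near=> n.
rewrite sub0r normrN ger0_norm ?normc_ge0//.
rewrite ltNge; apply/negP => ew.
have : `|0 - Normc.normc (w n) `^ alpha| < e `^ alpha.
  by near: n; apply: w0; exact: powR_gt0.
rewrite sub0r normrN ger0_norm ?powR_ge0// ltNge => /negP; apply.
by rewrite ge0_ler_powR// ?nnegrE ?(ltW a0)// ?(ltW e0)// (le_trans (ltW e0)).
Unshelve. all: by end_near. Qed.

Section CantorBase.
Variables (d : nat -> nat) (hd : cantor_base d).
Local Notation q := (cantor_q d).

(** Telescoping, as (d_j - 1) q_(j-1) = q_j - q_(j-1). Hence the r-th backward jump from n lands at
    n + 1 - q_r. *)
Lemma cantor_base_pred_sum r :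
  (\sum_(1 <= j < r.+1) (d j).-1 * q j.-1)%N = (q r).-1.
Proof.
elim: r => [|r IH]; first by rewrite big_geq// cantor_q0.
rewrite big_nat_recr//= IH cantor_qS.
have := cantor_q_gt0 hd r; have := hd.2 r.+1 isT.
by move: (q r) (d r.+1) => a b; nia.
Qed.

(** The first k digits of q_k (t + 1) - 1 are maximal, and the next one is t mod d_(k+1). *)
Lemma zeta_cantor_q k t : (t %% d k.+1 != (d k.+1).-1)%N ->
  zeta hd (q k * t.+1).-1 = k.+1.
Proof.
move=> td; rewrite /zeta; case: ex_minnP => j /andP[j1 jd] jmin.
apply/eqP; rewrite eqn_leq jmin/=; last first.
  rewrite /digit/= divn_pred mulKn ?(cantor_q_gt0 hd)//.
  by rewrite dvdn_mulr// subn1.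
rewrite ltnNge; apply/negP => jk; move: jd; case: j j1 jk {jmin} => // i _ ik.
have /dvdnP[e eqk] := cantor_q_dvd d ik.
rewrite /digit/= eqk cantor_qS.
(* The quotient of q_k (t + 1) - 1 by q_i is d_(i+1) e (t + 1) - 1, congruent to -1 modulo d_(i+1),
   so this digit is maximal. *)
have -> : (e * (q i * d i.+1) * t.+1 = q i * (d i.+1 * (e * t.+1)))%N.
  by ring.
rewrite divn_pred mulKn ?(cantor_q_gt0 hd)// dvdn_mulr// subn1.
have e0 : (0 < e)%N.
  by have := cantor_q_gt0 hd k; rewrite eqk; case: (e).
have d2 := hd.2 i.+1 isT.
rewrite modn_pred; last 2 first.
- by move: d2; case: (d i.+1) => [|[]].
- by rewrite !muln_gt0 e0 (leq_trans _ d2).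
by rewrite dvdn_mulr// eqxx.
Qed.

End CantorBase.

Arguments zeta_cantor_q {d} hd {k t}.

Section Eigenvector.
Variables (R : realType) (d : nat -> nat) (hd : cantor_base d) (p : nat -> R).
Hypothesis p01 : forall j, (1 <= j)%N -> 0 < p j <= 1.
Local Notation q := (cantor_q d).
Local Notation "x %:C" := (real_complex R x).

(** The hypothesis keeps [n.+1 - q r] from being truncated. *)
Lemma stoch_op_zeta (w : nat -> R[i]) n :
  (forall r, (1 <= r < zeta hd n)%N -> (q r <= n.+1)%N) ->
  stoch_op hd p w n =
    (\prod_(1 <= j < (zeta hd n).+1) p j)%:C * w n.+1
    + (1 - p 1%N)%:C * w n
    + \sum_(1 <= r < zeta hd n)
        ((1 - p r.+1) * \prod_(1 <= j < r.+1) p j)%:C * w (n.+1 - q r)%N.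
Proof.
move=> qn; rewrite stoch_opE 2!big_ord_recr/=.
rewrite {2 3}/stoch eqxx [X in if X then _ else _]ltn_eqF// eqxx.
rewrite -addrA addrC [X in X + _]addrC; congr (_ + _).
under eq_bigr => m _.
  rewrite /stoch ltn_eqF ?(ltn_trans (ltn_ord m))// ltn_eqF//.
  rewrite rmorph_sum/= mulr_suml; over.
rewrite (exchange_big_dep xpredT)//=; apply: eq_big_nat => r r1.
(* Since q_r >= 2, the target n + 1 - q_r lies strictly below the diagonal index n. *)
have qr2 : (1 < q r)%N.
  by apply: leq_ltn_trans (cantor_q_gt hd r); case/andP: r1.
have rn : (n.+1 - q r < n)%N by have := qn _ r1; lia.
rewrite (big_pred1 (Ordinal rn))//= => m.
rewrite cantor_base_pred_sum// [RHS]/= -val_eqE/=.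
by have qr := qn _ r1; apply/eqP/eqP; lia.
Qed.

Variables (lambda : R[i]) (w : nat -> R[i]).
Hypothesis ev : forall n, stoch_op hd p w n = lambda * w n.

Let pC_neq0 j : (1 <= j)%N -> (p j)%:C != 0.
Proof. by move=> /p01/andP[pj _]; rewrite fmorph_eq0 gt_eqF. Qed.

(** The entry in column n + 1 of row n is positive, so this row determines w (n + 1) from the
    earlier values. *)
Lemma eigenvector_neq0 : w != 0 -> w 0%N != 0.
Proof.
apply: contra_neq => w0; apply/funext => n.
elim/ltn_ind: n => -[//|n] IH; have := ev n.
rewrite stoch_opE big_ord_recr/= big1 => [|m _]; last first.
  by rewrite IH ?mulr0.
rewrite (IH n)// mulr0 add0r => /eqP; rewrite mulf_eq0 fmorph_eq0.
rewrite /stoch eqxx => /orP[|/eqP//].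
rewrite gt_eqF// big_nat; apply: prodr_gt0 => j /andP[j1 _].
by have /andP[] := p01 _ j1.
Qed.

Fixpoint rho (k : nat) : R[i] :=
  if k is k'.+1
  then (rho k' ^+ d k - (1 - p k.+1)%:C) / (p k.+1)%:C
  else (lambda - (1 - p 1%N)%:C) / (p 1%N)%:C.

(** As q_k (t + 1) - q_r is q_k t plus the sum of (d_(j+1) - 1) q_j over r <= j < k, each increment
    by q_j contributes one factor rho_j. *)
Let F k r := \prod_(r <= j < k) rho j ^+ (d j.+1).-1.

Let step k := forall t, (t %% d k.+1 != (d k.+1).-1)%N ->
  w (q k * t.+1)%N = rho k * w (q k * t)%N.

Let block k := forall t r, (r <= k)%N ->
  w (q k * t.+1 - q r)%N = F k r * w (q k * t)%N.

(* At [i = k], this turns the eigenvalue equation in row [q_k (t + 1) - 1], for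
   which [zeta] is [k + 1], into [step k]. *)
Let telescope k i : (i <= k)%N ->
  (lambda - (1 - p 1%N)%:C) * F k 0
  - \sum_(1 <= r < i.+1)
      ((1 - p r.+1) * \prod_(1 <= j < r.+1) p j)%:C * F k r =
  (\prod_(1 <= j < i.+2) p j)%:C * rho i * F k i.
Proof.
elim: i => [_|i IH ik].
  rewrite [X in _ - X]big_geq// subr0 big_nat1; congr (_ * _).
  by rewrite /= mulrCA divff ?mulr1// pC_neq0.
rewrite big_nat_recr//= opprD addrA IH ?(ltnW ik)//.
(* The factor split off here completes rho_i to rho_i ^ d_(i+1), the power in the recurrence for
   rho_(i+1). *)
rewrite /F (big_ltn ik) -/(F k i.+1).
rewrite [\prod_(1 <= j < i.+3) _]big_nat_recr//= !rmorphM/=.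
set P := (\prod_(1 <= j < i.+2) p j)%:C.
have -> : rho i ^+ d i.+1 = rho i * rho i ^+ (d i.+1).-1.
  by rewrite -exprS prednK// (leq_trans _ (hd.2 i.+1 isT)).
have := pC_neq0 i.+2 isT; move: (p i.+2)%:C => x x0.
by field.
Qed.

(** In row q_k (t + 1) - 1, [block k] makes every value except w (q_k (t + 1)) a multiple of w (q_k
    t). *)
Let block_step k : block k -> step k.
Proof.
move=> blk t td; have q0 := cantor_q_gt0 hd k.
have n1 : ((q k * t.+1).-1.+1 = q k * t.+1)%N by rewrite prednK// muln_gt0 q0.
have zk := zeta_cantor_q hd td.
have := ev (q k * t.+1).-1; rewrite stoch_op_zeta; last first.
  move=> r; rewrite zk ltnS => /andP[_ rk].
  rewrite n1 (@leq_trans (q k))//; last by rewrite leq_pmulr.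
  by rewrite dvdn_leq// cantor_q_dvd.
rewrite zk n1.
under [X in _ + X = _ -> _]eq_big_nat => r /andP[_ rk] do rewrite blk// mulrA.
rewrite -mulr_suml.
(* The diagonal term is the case r = 0 of [block k]. *)
have -> : (q k * t.+1).-1 = (q k * t.+1 - q 0)%N by rewrite cantor_q0// subn1.
rewrite blk// => E.
have := telescope k k (leqnn k); have -> : F k k = 1 by rewrite /F big_geq.
rewrite mulr1.
set P := (\prod_(1 <= j < k.+2) p j)%:C in E *.
have P0 : P != 0.
  rewrite fmorph_eq0 gt_eqF// big_nat; apply: prodr_gt0 => j /andP[j1 _].
  by have /andP[] := p01 _ j1.
move=> T; apply: (mulfI P0); rewrite mulrA -T mulrBl -mulrA.
move: E; rewrite /F.
set S := \sum_(1 <= _ < _) _; set f := \prod_(0 <= _ < _) _.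
move=> E; have {}E : P * w (q k * t.+1)%N =
   lambda * (f * w (q k * t)%N) - (1 - p 1%N)%:C * (f * w (q k * t)%N)
   - S * w (q k * t)%N by rewrite -E; ring.
by rewrite E; ring.
Qed.

(** The bound on s means that [step k] is only used at residues below d_(k+1) - 1. *)
Let step_iter k : step k -> forall t s, (s < d k.+1)%N ->
  w (q k * (t * d k.+1 + s))%N = rho k ^+ s * w (q k.+1 * t)%N.
Proof.
move=> stp t; elim=> [_|s IH sd].
  by rewrite addn0 expr0 mul1r cantor_qS -mulnA [(t * _)%N]mulnC.
rewrite addnS stp ?IH ?(ltnW sd)// ?exprS ?mulrA//.
by rewrite modnMDl modn_small ?(ltnW sd)//; lia.
Qed.

Let blockE k : block k.
Proof.
elim: k => [t r|k IH t r].
  rewrite leqn0 => /eqP ->; rewrite /F big_geq// mul1r cantor_q0//.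
  by rewrite !mul1n subn1.
rewrite leq_eqVlt => /orP[/eqP ->|rk].
  by rewrite /F big_geq// mul1r mulnSr addnK.
have d2 := hd.2 k.+1 isT.
(* [block k] holds at every residue, so it covers the last subblock of length q_k; the d_(k+1) - 1
   steps before it give the missing factor of [F k.+1 r]. *)
have -> : (q k.+1 * t.+1 = q k * (t * d k.+1 + (d k.+1).-1).+1)%N.
  by rewrite cantor_qS -addnS prednK ?(leq_trans _ d2)//; ring.
rewrite IH// (step_iter _ (block_step _ IH)) ?ltn_predL ?(leq_trans _ d2)//.
by rewrite mulrA /F big_nat_recr.
Qed.

Lemma eigenvector_cantor_q k : w (q k) = rho k * w 0%N.
Proof.
have := block_step k (blockE k) 0; rewrite muln1 muln0; apply.
by rewrite mod0n; have := hd.2 k.+1 isT; case: (d k.+1) => [|[]].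
Qed.

Lemma rho_cvg0 : c0_space R w -> w != 0 ->
  Normc.normc (rho k) @[k --> \oo] --> (0 : R).
Proof.
move=> wc0 /eigenvector_neq0 w0.
have nw0 : Normc.normc (w 0%N) != 0.
  by apply: contra_neq w0; exact: Normc.eq0_normc.
have -> : (fun k => Normc.normc (rho k)) =
          (fun k => Normc.normc (w (q k)) / Normc.normc (w 0%N)).
  by apply/funext => k; rewrite eigenvector_cantor_q Normc.normcM mulfK.
rewrite -[X in _ --> X](mul0r (Normc.normc (w 0%N))^-1).
apply: cvgMr_tmp.
(* Restrict w to the indices q_k, which tend to infinity because q_k > k. *)
apply: (cvg_comp q (fun n => Normc.normc (w n)) _ wc0).
apply/cvgnyPge => A; near=> k.
rewrite ltnW// (leq_ltn_trans _ (cantor_q_gt hd k))//; near: k.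
exact: nbhs_infty_ge.
Unshelve. all: by end_near. Qed.

(** Triangle inequality in 1 - p_(k+2) = rho_k ^ d_(k+1) - p_(k+2) rho_(k+1), where the power has
    modulus at most that of rho_k. *)
Lemma one_sub_le_rho k : Normc.normc (rho k) <= 1 ->
  1 - p k.+2 <= Normc.normc (rho k) + Normc.normc (rho k.+1).
Proof.
move=> i1; have /andP[p0 p1] := p01 k.+2 isT.
have normcC (x : R) : 0 <= x -> Normc.normc x%:C = x.
  by move=> x0; rewrite /= expr0n addr0 sqrtr_sqr ger0_norm.
have E : (1 - p k.+2)%:C = rho k ^+ d k.+1 + - ((p k.+2)%:C * rho k.+1).
  by rewrite /= [_ * (_ / _)]mulrC divfK ?pC_neq0//; ring.
rewrite -[leLHS]normcC ?subr_ge0// E (le_trans (le_normcD _ _))//.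
rewrite normcN Normc.normcM normcC ?(ltW p0)// lerD//; last first.
  by rewrite ler_piMl// normc_ge0.
have -> : Normc.normc (rho k ^+ d k.+1) = Normc.normc (rho k) ^+ d k.+1.
  elim: (d k.+1) => [|m IH]; first by rewrite !expr0 Normc.normc1.
  by rewrite !exprS Normc.normcM IH.
have := hd.2 k.+1 isT; case: (d k.+1) => // m _.
by rewrite exprS ler_piMr ?exprn_ile1// normc_ge0.
Qed.

End Eigenvector.

Theorem proposition4p5 (R : realType) (d : nat -> nat) (hd : cantor_base d)
    (p : nat -> R) (hp : forall j, (1 <= j)%N -> 0 < p j <= 1)
    (Omega : set (nat -> R[i]))
    (hOmega : Omega = c0_space R \/
              exists2 alpha : R, 1 <= alpha & Omega = l_space alpha)
    (hp1 : ~ (p n @[n --> \oo] --> (1 : R))) :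
  point_spectrum Omega (stoch_op hd p) = set0.
Proof.
apply/seteqP; split=> // lambda [w [wO wn0 ev]]; apply: hp1.
have wc0 : c0_space R w.
  by case: hOmega wO => [-> //|[a a1 ->]]; exact: c0_space_l_space.
have i0 := rho_cvg0 _ _ _ _ hp _ _ ev wc0 wn0.
suff : (1 - p n.+2) @[n --> \oo] --> (0 : R).
  move=> p1; rewrite -(cvg_shiftn 2).
  have -> : (fun n => p (n + 2)%N) = (fun n => 1 - (1 - p n.+2)).
    by apply/funext => n; rewrite addn2; ring.
  have := cvgB (cvg_cst (1 : R)) p1; rewrite subr0; apply.
(* The upper bound is |rho_n| + |rho_(n+1)|, valid once |rho_n| <= 1. *)
apply: (@squeeze_cvgr _ _ _ _ (cst 0) (fun n => _ + _) _ _ _ (cvg_cst _)).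
- near=> n; apply/andP; split.
    by rewrite subr_ge0; have /andP[] := hp n.+2 isT.
  apply: (one_sub_le_rho _ _ hd _ hp lambda).
  near: n; exact: (cvgr_le _ i0 _ ltr01).
- rewrite -[X in _ --> X](addr0 0); apply: cvgD => //.
  by move: i0; rewrite -cvg_shiftS.
Unshelve. all: by end_near. Qed.
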